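(* In the finite-state regularized setting of the context, suppose that (1) there exists $\varepsilon\in(0,1)$ with $\displaystyle\frac{\sqrt{\hat K}}{\sqrt{\hat K}+\sqrt{\hat K-\bar K}}>\beta^{1-\varepsilon}$ (fix such $\varepsilon$), and (2) $\sqrt{\hat K\beta}+\sqrt{(\hat K-\bar K)\beta}<1$. Let $((\pi_t)_{t\ge0},(\mu_t)_{t\ge0})$ be a mean-field equilibrium of the regularized infinite-horizon non-stationary game and, for each $T\ge 2$, let $((\pi^T_t)_{t=0}^{T-1},(\mu^T_t)_{t=0}^{T-1})$ be a mean-field equilibrium of the regularized $T$-horizon game, all with the same initial state-measure $\mu_0=\mu_0^T$. Then $$\|\mu_t-\mu^T_t\|_{\mathrm{TV}}\le O\left(\frac{2T-1}{T-t}\left(\sqrt{\frac{\hat K}{\rho(A_T)\beta}}\right)^{t}\beta^{T\varepsilon}\right)\quad\text{for all sufficiently large }T,$$ i.e. there are constants $D$ and $T_0$ (independent of $t$ and $T$) such that for all $T\ge T_0$ and $0\le t<T$ the left side is at most $D$ times the expression inside $O(\cdot)$. In particular, the regularized infinite-horizon non-stationary game with initial measure $\mu_0$ has a unique mean-field equilibrium.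
   Context: $X$ and $A$ are finite sets; $\mathcal P(\cdot)$ denotes the set of probability measures; $\|\mu-\nu\|_{\mathrm{TV}}=\frac12\sum_{x}|\mu(x)-\nu(x)|$. Fix $\beta\in(0,1)$, $\mu_0\in\mathcal P(X)$, $c:X\times A\times\mathcal P(X)\to\mathbb R$ and $p:X\times A\times\mathcal P(X)\to\mathcal P(X)$ such that, with constants $L_1,K_1>0$, $\beta K_1<2$, for all $x,\hat x,a,\hat a,\mu,\hat\mu$: $|c(x,a,\mu)-c(\hat x,\hat a,\hat\mu)|\le L_1(1_{\{x\ne\hat x\}}+2\cdot1_{\{a\neq\hat a\}}+2\|\mu-\hat\mu\|_{\mathrm{TV}})$ and $\|p(\cdot|x,a,\mu)-p(\cdot|\hat x,\hat a,\hat\mu)\|_{\mathrm{TV}}\le\frac{K_1}{2}(1_{\{x\ne\hat x\}}+2\cdot 1_{\{a\neq\hat a\}}+2\|\mu-\hat\mu\|_{\mathrm{TV}})$. For $u\in\mathcal P(A)$ put $C(x,u,\mu)=\sum_a c(x,a,\mu)u(a)$, $P(\cdot|x,u,\mu)=\sum_a p(\cdot|x,a,\mu)u(a)$. The regularizer $\Omega:\mathcal P(A)\to\mathbb R$ is continuous and $\rho$-strongly convex with respect to $\|\cdot\|_1$, $\rho>0$: $\Omega(su+(1-s)v)\le s\Omega(u)+(1-s)\Omega(v)-\frac{\rho}{2}s(1-s)\|u-v\|_1^2$. Constants: $\bar L=\frac{L_1}{1-\beta K_1/2}$, $\bar K=\frac{3K_1}{2}+\frac{K_1\bar L}{2\rho(1-\beta)}$,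 $\hat K=\bar K+\frac{K_1\bar L}{\rho}$. For $T\ge2$, $A_T=(a_{ij})_{i,j=1}^{T-1}$ has $a_{ij}=\frac{\bar LK_1}{\rho}\beta^{\,j-i+1}$ for $j\ge i$, $a_{i,i-1}=\hat K$, $a_{ij}=0$ for $j<i-1$; $\rho(A_T)$ is its spectral radius ($\rho$ alone is the strong convexity constant). Equilibria. Infinite horizon: for a flow $(\mu_t)_{t\ge0}$ in $\mathcal P(X)$ there is a unique uniformly bounded sequence $(Q_t)_{t\ge0}$ on $X\times\mathcal P(A)$ with $Q_t(x,u)=C(x,u,\mu_t)+\Omega(u)+\beta\sum_y\min_{b\in\mathcal P(A)}Q_{t+1}(y,b)P(y|x,u,\mu_t)$. Finite horizon $T$: for $(\mu_t)_{t=0}^{T-1}$ the $Q_t$, $0\le t\le T-1$, are defined by $Q_{T-1}(x,u)=C(x,u,\mu_{T-1})+\Omega(u)$ and the same recursion for $t\le T-2$. Each $Q_t(x,\cdot)$ has a unique minimizer $f_t(x)$. A mean-field equilibrium (in either case) with initial measure $\mu_0$ is a pair of flows $((\pi_t),(\mu_t))$, with first state measure $\mu_0$, such that $\pi_t(\cdot|x)=\delta_{f_t(x)}$ for all $t,x$ and $\mu_{t+1}=\sum_xP(\cdot|x,f_t(x),\mu_t)\mu_t(x)$ (for all $t\ge0$, resp. $0\le t\le T-2$). *)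

(* Defs.v *)
From HB Require Import structures.
From mathcomp Require Import all_boot all_order all_algebra.
From mathcomp Require Import complex.
From mathcomp Require Import all_classical all_reals all_analysis.
Set Implicit Arguments.
Unset Strict Implicit.
Unset Printing Implicit Defensive.
Import Order.TTheory GRing.Theory Num.Theory.
Import numFieldNormedType.Exports.

Local Open Scope classical_set_scope.
Local Open Scope ring_scope.

(* Nonempty finite sets: the library's measurable types are pointed, so a base
   point of the action set is needed to speak of measures on P(A). *)
#[short(type=pointedFinType)]
HB.structure Definition PointedFinite := {T of Pointed T & Finite T}.

(* Probability measures on a finite set are given by their mass functions. *)
Definition simplex (R : realType) (X : finType) : set {ptws X -> R} :=
  [set f | (forall x, 0 <= f x) /\ \sum_x f x = 1].
Arguments simplex : clear implicits.

(* P(X), with the topology induced by that of R^X. *)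
Definition dist (R : realType) (X : finType) : Type := set_type (simplex R X).

HB.instance Definition _ (R : realType) (X : finType) :=
  Topological.copy (dist R X) (set_type (simplex R X)).

Definition mass (R : realType) (X : finType) (mu : dist R X) (x : X) : R :=
  set_val mu x.
Coercion mass : dist >-> Funclass.

Lemma simplex_point (R : realType) (A : pointedFinType) :
  (fun a : A => (a == point)%:R : R) \in simplex R A.
Proof.
apply/mem_set; split=> [a|]; first exact: ler0n.
by rewrite (bigD1 point)//= eqxx big1 ?addr0// => a /negbTE ->.
Qed.

HB.instance Definition _ (R : realType) (A : pointedFinType) :=
  isPointed.Build (dist R A) (SigSub (simplex_point R A)).

(* P(A) with its Borel sigma-algebra. *)
Notation borel_dist R A := (g_sigma_algebraType (@open (dist R A))).

Definition tv (R : realType) (X : finType) (mu nu : dist R X) : R :=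
  2^-1 * \sum_x `|mu x - nu x|.

Definition norm1 (R : realType) (A : finType) (u v : dist R A) : R :=
  \sum_a `|u a - v a|.

Definition strongly_convex (R : realType) (A : finType) (rho : R)
    (Omega : dist R A -> R) : Prop :=
  forall (u v w : dist R A) (s : R), 0 <= s <= 1 ->
    (forall a, w a = s * u a + (1 - s) * v a) ->
    Omega w <= s * Omega u + (1 - s) * Omega v
               - rho / 2 * s * (1 - s) * norm1 u v ^+ 2.

Definition modulus (R : realType) (X A : finType) (x x' : X) (a a' : A)
    (mu mu' : dist R X) : R :=
  (x != x')%:R + 2 * (a != a')%:R + 2 * tv mu mu'.

Section Constants.
Context {R : realType} (beta L1 K1 rho : R).

Definition Lbar : R := L1 / (1 - beta * K1 / 2).
Definition Kbar : R := 3 * K1 / 2 + K1 * Lbar / (2 * rho * (1 - beta)).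
Definition Khat : R := Kbar + K1 * Lbar / rho.

(* Indices are shifted by one: row and column k stand for k + 1. *)
Definition AT (T : nat) : 'M[R]_(T.-1) :=
  \matrix_(i, j)
    if (i <= j)%N then Lbar * K1 / rho * beta ^+ (j - i + 1)
    else if i == j.+1 :> nat then Khat else 0.

End Constants.

(* Largest modulus of a complex eigenvalue. *)
Definition spectral_radius (R : realType) (n : nat) (M : 'M[R]_n) : R :=
  sup [set ComplexField.Normc.normc z | z in
        [set z : R[i] | eigenvalue (map_mx (real_complex R) M) z]].

(* The minimum of g (0 if g has no minimum). *)
Definition minval (R : realType) (U : Type) (g : U -> R) : R :=
  xget 0 [set m | (exists u, g u = m) /\ (forall u, m <= g u)].

Definition is_argmin (R : realType) (U : Type) (g : U -> R) (u : U) : Prop :=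
  forall v, g u <= g v.

Section Game.
Context {R : realType} {X : finType} {A : pointedFinType}.
Context (beta : R) (mu0 : dist R X) (c : X -> A -> dist R X -> R)
  (p : X -> A -> dist R X -> dist R X) (Omega : dist R A -> R).

Definition cost (x : X) (u : dist R A) (mu : dist R X) : R :=
  \sum_a c x a mu * u a.

Definition trans (x : X) (u : dist R A) (mu : dist R X) (y : X) : R :=
  \sum_a p x a mu y * u a.

Definition bellman (mu : dist R X) (Q' : X -> dist R A -> R)
    (x : X) (u : dist R A) : R :=
  cost x u mu + Omega u + beta * \sum_y minval (Q' y) * trans x u mu y.

Definition isQ (mu : nat -> dist R X) (Q : nat -> X -> dist R A -> R) : Prop :=
  (exists M : R, forall t x u, `|Q t x u| <= M) /\
  (forall t x u, Q t x u = bellman (mu t) (Q t.+1) x u).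

(* Finite-horizon objects are indexed by all of nat; only their values at
   t < T are constrained. *)
Definition isQ_fin (T : nat) (mu : nat -> dist R X)
    (Q : nat -> X -> dist R A -> R) : Prop :=
  (forall x u, Q T.-1 x u = cost x u (mu T.-1) + Omega u) /\
  (forall t x u, (t.+1 < T)%N -> Q t x u = bellman (mu t) (Q t.+1) x u).

Definition is_next (f : X -> dist R A) (mu mu' : dist R X) : Prop :=
  forall y, mu' y = \sum_x trans x (f x) mu y * mu x.

(* A relaxed policy: pi t x is a Borel probability measure on P(A). Measures
   are compared on measurable sets only, as the library leaves their values
   elsewhere arbitrary. *)
Definition policy := nat -> X -> probability (borel_dist R A) R.

Definition is_dirac (P : probability (borel_dist R A) R) (u : dist R A) : Prop :=
  forall B : set (borel_dist R A), measurable B -> P B = dirac (u : borel_dist R A) B.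

Definition is_mfe (pi : policy) (mu : nat -> dist R X) : Prop :=
  exists (Q : nat -> X -> dist R A -> R) (f : nat -> X -> dist R A),
  [/\ mu 0%N = mu0,
      isQ mu Q,
      forall t x, is_argmin (Q t x) (f t x),
      forall t x, is_dirac (pi t x) (f t x) &
      forall t, is_next (f t) (mu t) (mu t.+1)].

Definition is_mfe_fin (T : nat) (pi : policy) (mu : nat -> dist R X) : Prop :=
  exists (Q : nat -> X -> dist R A -> R) (f : nat -> X -> dist R A),
  [/\ mu 0%N = mu0,
      isQ_fin T mu Q,
      forall t x, (t < T)%N -> is_argmin (Q t x) (f t x),
      forall t x, (t < T)%N -> is_dirac (pi t x) (f t x) &
      forall t, (t.+1 < T)%N -> is_next (f t) (mu t) (mu t.+1)].

End Game.

Arguments policy : clear implicits.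

(* Main.v *)
(** Weigh the distance of two flows by [r ^ t] with
    [r = sqrt Kh / (beta (sqrt Kh + sqrt (Kh - Kb)))]. Perturbing the flow by
    [m r ^ t] perturbs the values, hence the unique minimisers, hence the next
    state measure by at most [s m r ^ (t + 1)], up to a boundary term
    [O(beta ^ (T - t))] at the horizon, where
    [s = Kh / r + (Kh - Kb) beta / (1 - beta r)
       = beta (sqrt Kh + sqrt (Kh - Kb)) ^ 2].
    Condition (2) says [s < 1]. So "optimal response, then next measure" is a
    contraction of flows, which gives existence and uniqueness in infinite
    horizon, and two equilibria up to time [T] differ by at most
    [D r ^ t beta ^ (T eps)], the boundary term being absorbed because
    condition (1) says [r beta ^ eps > 1]. Finally [(r ^ j)_j] is a positive
    vector [w] with [A_T w <= s w], so [0 < rho(A_T) <= s] (positivity by the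
    trace) and [r <= sqrt (Kh / (rho(A_T) beta))]. *)
Require Import Defs.
From HB Require Import structures.
From mathcomp Require Import all_boot all_order all_algebra.
From mathcomp Require Import complex.
From mathcomp Require Import all_classical all_reals all_analysis.
From mathcomp Require Import ring lra.
Set Implicit Arguments.
Unset Strict Implicit.
Unset Printing Implicit Defensive.
Import Order.TTheory GRing.Theory Num.Theory.
Import numFieldNormedType.Exports.
Local Open Scope classical_set_scope.
Local Open Scope ring_scope.

(** * Compactness of the simplex *)

Section Compactness.
Context {R : realType} {X : finType}.

Lemma compact_simplex : compact (simplex R X).
Proof.
have cube : compact [set f : {ptws X -> R} | forall x, `[0, 1]%classic (f x)].
  apply: (@tychonoff X (fun=> R) (fun=> `[0, 1]%classic)) => x.
  exact: segment_compact.
apply: (subclosed_compact _ cube); last first.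
  move=> f [f0 f1] x; rewrite /= in_itv/= f0/= -f1 (bigD1 x)//= lerDl.
  exact: sumr_ge0.
have cproj x : continuous (fun f : {ptws X -> R} => f x).
  by move=> f; exact: (@proj_continuous X (fun=> R) x f).
have -> : simplex R X =
    (\bigcap_x (fun f : {ptws X -> R} => f x) @^-1` [set r | 0 <= r]) `&`
    (fun f : {ptws X -> R} => \sum_x f x) @^-1` [set 1].
  apply/seteqP; split=> [f [f0 f1]|f [f0 f1]]; split=> //=.
  - by move=> x _; exact: f0.
  - by move=> x; exact: f0.
apply: closedI.
  apply: closed_bigI => x _; apply: closed_comp => [f _|]; first exact: cproj.
  exact: closed_ge.
apply: closed_comp => [f _|]; last exact: closed_eq.
apply: (continuous_big (op := +%R)) => [|x _]; first exact: add_continuous.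
exact: cproj.
Qed.

(** A filter on [dist R X] is pushed forward to the functions [X -> R]; the cluster point found in
    the simplex lifts back because the opens of [dist R X] are preimages of opens. *)
Lemma compact_dist : compact [set: dist R X].
Proof.
move=> F FF _.
have FS : (set_val @ F) (simplex R X).
  by apply: (@filterE _ F) => u; exact: set_mem (valP u).
have [f [fS clf]] := compact_simplex (fmap_proper_filter _ FF) FS.
exists (SigSub (mem_set fS) : dist R X); split=> // B C FB.
rewrite nbhsE => -[_ [[U oU <-] Uf] UC].
have FB' : (set_val @ F) (set_val @` B).
  by apply: (@filterS _ F _ B) FB => u Bu; exists u.
have fU : nbhs f U by apply: open_nbhs_nbhs.
have [_ [[u Bu <-] Uu]] := clf _ _ FB' fU.
by exists u; split=> //; exact: UC.
Qed.

Lemma mass_continuous (x : X) : continuous (fun u : dist R X => u x).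
Proof.
move=> u.
apply: (@continuous_comp _ _ _ set_val (fun f : {ptws X -> R} => f x)).
  exact: initial_continuous.
exact: (@proj_continuous X (fun=> R) x).
Qed.

End Compactness.

(** * Spectral radius of nonnegative matrices *)

Section SpectralRadius.
Context {R : realType}.
Import ComplexField.Normc.

(** With [v] a left eigenvector and [N] the sum of the [normc (v 0 i) * w i], the triangle
    inequality in [v M = z v] gives [normc z * N <= s * N], and [N] is positive. *)
Lemma normc_eigenvalue_le n (M : 'M[R]_n) (w : 'I_n -> R) (s : R) (z : R[i]) :
  (forall i j, 0 <= M i j) -> (forall i, 0 < w i) ->
  (forall i, \sum_j M i j * w j <= s * w i) ->
  eigenvalue (map_mx (real_complex R) M) z -> normc z <= s.
Proof.
move=> M_ge0 w_gt0 Mw /eigenvalueP[v vM v_neq0].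
have normcC (x : R) : 0 <= x -> normc (x%:C)%C = x.
  by move=> x0; rewrite /= expr0n/= addr0 sqrtr_sqr ger0_norm.
have normc_ge0 (x : R[i]) : 0 <= normc x by case: x => a b; exact: sqrtr_ge0.
pose N := \sum_i normc (v 0 i) * w i.
have N_gt0 : 0 < N.
  have /rV0Pn[i vi] := v_neq0.
  rewrite /N (bigD1 i)//= ltr_wpDr//.
    by apply: sumr_ge0 => j _; rewrite mulr_ge0// ltW.
  rewrite mulr_gt0// lt0r normc_ge0 andbT.
  by apply: contra_neq vi; exact: eq0_normc.
have normc_sum (F : 'I_n -> R[i]) : normc (\sum_i F i) <= \sum_i normc (F i).
  elim/big_ind2: _ => [|x1 x2 y1 y2 h1 h2|i _]; rewrite ?normc0//.
  by rewrite (le_trans (le_normcD _ _))// lerD.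
rewrite -(ler_pM2r N_gt0) {1}/N mulr_sumr.
apply: (@le_trans _ _ (\sum_j (\sum_i normc (v 0 i) * M i j) * w j)).
  apply: ler_sum => j _; rewrite mulrA ler_wpM2r ?(ltW (w_gt0 _))// -normcM.
  have /rowP/(_ j) := vM; rewrite !mxE => <-.
  rewrite (le_trans (normc_sum _))//; apply: ler_sum => i _.
  by rewrite normcM mxE normcC.
under eq_bigr do rewrite mulr_suml.
rewrite exchange_big/= /N mulr_sumr; apply: ler_sum => i _.
under eq_bigr do rewrite -mulrA.
by rewrite -mulr_sumr mulrCA ler_wpM2l.
Qed.

(** If every root of the characteristic polynomial were 0, it would be ['X^n], whose coefficient of
    degree [n.-1] is 0; but that coefficient is minus the trace. *)
Lemma exists_eigenvalue_neq0 n (M : 'M[R]_n) : \tr M != 0 ->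
  exists2 z : R[i], eigenvalue (map_mx (real_complex R) M) z & z != 0.
Proof.
move=> trM; set M' := map_mx _ M.
have n_gt0 : (0 < n)%N.
  by case: n M trM @M' => // M; rewrite /mxtrace big_ord0 eqxx.
have trM' : \tr M' != 0 by rewrite /M' trace_map_mx fmorph_eq0.
have [rs rsE] := closed_field_poly_normal (char_poly M').
rewrite (monicP (char_poly_monic M')) scale1r in rsE.
have szrs : size rs = n.
  by have := size_char_poly M'; rewrite rsE size_prod_XsubC => -[].
have [/hasP[z zrs z0]|/hasPn rs0] := boolP (has (fun z => z != 0) rs).
  by exists z => //; rewrite eigenvalue_root_char rsE root_prod_XsubC.
have : (char_poly M')`_n.-1 = 0.
  rewrite rsE (eq_big_seq (fun=> 'X)); last first.
    by move=> z /rs0; rewrite negbK => /eqP ->; rewrite subr0.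
  rewrite big_const_seq count_predT iter_mulr_1 szrs coefXn.
  by case: (n) n_gt0 => // m _; rewrite ltn_eqF.
by rewrite char_poly_trace// => /eqP; rewrite oppr_eq0 (negPf trM').
Qed.

(** The trace condition supplies a nonzero eigenvalue: its modulus makes the set under [sup]
    nonempty and bounds the [sup] below by a positive number. *)
Lemma spectral_radius_gt0_le n (M : 'M[R]_n) (w : 'I_n -> R) (s : R) :
  (forall i j, 0 <= M i j) -> (forall i, 0 < w i) ->
  (forall i, \sum_j M i j * w j <= s * w i) -> \tr M != 0 ->
  0 < spectral_radius M <= s.
Proof.
move=> M0 w0 Mw /exists_eigenvalue_neq0[z zM z0].
rewrite /spectral_radius; set E := [set _ | _ in _].
have Ez : E (normc z) by exists z.
have ubE : ubound E s.
  by move=> _ [y yM <-]; exact: (normc_eigenvalue_le M0 w0 Mw).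
apply/andP; split; last by apply: ge_sup => //; exists (normc z).
apply: (@lt_le_trans _ _ (normc z)); last by apply: ub_le_sup => //; exists s.
rewrite lt0r; apply/andP; split; last by case: (z) => a b; exact: sqrtr_ge0.
by apply: contra_neq z0; exact: eq0_normc.
Qed.

End SpectralRadius.

(** * Total variation and mixtures *)

Section Distributions.
Context {R : realType} {X : finType}.
Implicit Types mu nu : dist R X.

Lemma mass_ge0 mu x : 0 <= mu x.
Proof. by case: (set_valP mu) => h _; exact: h. Qed.

Lemma mass_sum1 mu : \sum_x mu x = 1.
Proof. by case: (set_valP mu) => _ h; exact: h. Qed.

Lemma dist_ext mu nu : mu =1 nu -> mu = nu.
Proof. by move=> e; apply: val_inj; apply: funext => x; exact: e. Qed.

Definition mkdist (f : X -> R) (f0 : forall x, 0 <= f x) (f1 : \sum_x f x = 1) :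
  dist R X :=
  SigSub (mem_set (conj f0 f1) : (f : {ptws X -> R}) \in simplex R X).

Lemma mkdistE f f0 f1 x : @mkdist f f0 f1 x = f x.
Proof. by []. Qed.

Lemma norm1_ge0 mu nu : 0 <= norm1 mu nu.
Proof. exact: sumr_ge0. Qed.

Lemma norm1_le0 mu nu : norm1 mu nu <= 0 -> mu = nu.
Proof.
move=> le0; have /eqP : norm1 mu nu = 0.
  by apply/eqP; rewrite eq_le le0 norm1_ge0.
rewrite psumr_eq0// => /allP e; apply: dist_ext => x; apply/eqP.
by rewrite -subr_eq0 -normr_eq0; apply: e; rewrite mem_index_enum.
Qed.

Lemma tvE mu nu : tv mu nu = norm1 mu nu / 2.
Proof. by rewrite /tv mulrC. Qed.

Lemma tv_ge0 mu nu : 0 <= tv mu nu.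
Proof. by rewrite tvE divr_ge0// norm1_ge0. Qed.

Lemma tvxx mu : tv mu mu = 0.
Proof. by rewrite /tv big1 ?mulr0// => x _; rewrite subrr normr0. Qed.

Lemma tv_sym mu nu : tv mu nu = tv nu mu.
Proof. by rewrite /tv; under eq_bigr do rewrite distrC. Qed.

Lemma tv_le0 mu nu : tv mu nu <= 0 -> mu = nu.
Proof. by rewrite tvE => ?; apply: norm1_le0; lra. Qed.

Lemma tv_triangle nu mu mu' : tv mu mu' <= tv mu nu + tv nu mu'.
Proof.
rewrite /tv -mulrDr ler_wpM2l// -big_split/=; apply: ler_sum => x _.
exact: ler_distD.
Qed.

Lemma tv_le1 mu nu : tv mu nu <= 1.
Proof.
suff : \sum_x `|mu x - nu x| <= 2 by rewrite /tv; lra.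
have -> : 2 = \sum_x (mu x + nu x) :> R by rewrite big_split/= !mass_sum1.
apply: ler_sum => x _; rewrite (le_trans (ler_normB _ _))//.
by rewrite !ger0_norm ?mass_ge0.
Qed.

Lemma mass_sub_le_tv mu nu x : `|mu x - nu x| <= 2 * tv mu nu.
Proof.
rewrite /tv mulVKf// (bigD1 x)//= lerDl; exact: sumr_ge0.
Qed.

(* Centring h at its midrange halves the factor: |h - mid| <= M / 2. *)
Lemma sum_le_osc (e h : X -> R) (M : R) :
  \sum_x e x = 0 -> (forall x x', h x - h x' <= M) ->
  \sum_x h x * e x <= M * (2^-1 * \sum_x `|e x|).
Proof.
move=> e0 hM; have [x0 _|X0] := pickP X; last first.
  by rewrite !big1 ?mulr0// => x; have := X0 x.
pose a := [arg max_(x > x0) h x]%O; pose b := [arg min_(x < x0) h x]%O.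
have ha x : h x <= h a by rewrite /a; case: arg_maxP => // i _; exact.
have hb x : h b <= h x by rewrite /b; case: arg_minP => // i _; exact.
have -> : \sum_x h x * e x = \sum_x (h x - (h a + h b) / 2) * e x.
  under [RHS]eq_bigr do rewrite mulrBl.
  by rewrite sumrB -mulr_sumr e0 mulr0 subr0.
rewrite mulrA mulr_sumr; apply: ler_sum => x _.
rewrite (le_trans (ler_norm _))// normrM ler_wpM2r//.
by rewrite ler_norml; have := ha x; have := hb x; have := hM a b; lra.
Qed.

Lemma sum_le_tv mu nu (h : X -> R) (M : R) :
  (forall x x', h x - h x' <= M) ->
  \sum_x h x * mu x - \sum_x h x * nu x <= M * tv mu nu.
Proof.
move=> hM; rewrite -sumrB; under eq_bigr do rewrite -mulrBr.
by apply: sum_le_osc => //; rewrite sumrB !mass_sum1 subrr.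
Qed.

Lemma mean_le mu (h : X -> R) (M : R) :
  (forall x, h x <= M) -> \sum_x h x * mu x <= M.
Proof.
move=> hM; rewrite -[leRHS]mulr1 -(mass_sum1 mu) mulr_sumr.
by apply: ler_sum => x _; rewrite ler_wpM2r ?mass_ge0.
Qed.

Lemma norm_mean_le mu (h : X -> R) (M : R) :
  (forall x, `|h x| <= M) -> `|\sum_x h x * mu x| <= M.
Proof.
move=> hM; rewrite (le_trans (ler_norm_sum _ _ _))//.
under eq_bigr do rewrite normrM (ger0_norm (mass_ge0 _ _)).
exact: mean_le.
Qed.

Lemma dist_inhabited mu : exists x : X, true.
Proof.
have [x _|X0] := pickP X; first by exists x.
have := mass_sum1 mu; rewrite big1 => [/esym/eqP|x]; first by rewrite oner_eq0.
by have := X0 x.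
Qed.

End Distributions.

Section Mixtures.
Context {R : realType} {X Y : finType}.

Lemma mix_ge0 (mu : dist R X) (k : X -> dist R Y) y : 0 <= \sum_x k x y * mu x.
Proof. by apply: sumr_ge0 => x _; rewrite mulr_ge0 ?mass_ge0. Qed.

Lemma mix_sum1 (mu : dist R X) (k : X -> dist R Y) :
  \sum_y \sum_x k x y * mu x = 1.
Proof.
rewrite exchange_big/= -(mass_sum1 mu); apply: eq_bigr => x _.
by rewrite -mulr_suml mass_sum1 mul1r.
Qed.

Definition mix (mu : dist R X) (k : X -> dist R Y) : dist R Y :=
  mkdist (mix_ge0 mu k) (mix_sum1 mu k).

Lemma sum_mix (mu : dist R X) (k : X -> dist R Y) (h : Y -> R) :
  \sum_y h y * mix mu k y = \sum_x (\sum_y h y * k x y) * mu x.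
Proof.
under eq_bigr do rewrite mkdistE mulr_sumr.
rewrite exchange_big/=; apply: eq_bigr => x _.
by rewrite mulr_suml; apply: eq_bigr => y _; rewrite mulrA.
Qed.

(* Testing against the sign of the difference turns 2 tv into a linear
   functional. *)
Lemma tv_sgE (mu nu : dist R Y) :
  exists2 h : Y -> R, (forall y y', h y - h y' <= 2) &
    2 * tv mu nu = \sum_y h y * mu y - \sum_y h y * nu y.
Proof.
exists (fun y => Num.sg (mu y - nu y)) => [y y'|].
  have sg1 (z : R) : -1 <= Num.sg z <= 1.
    by case: sgrP => _; rewrite ?lexx ?lerN10 ?ler01//= ?ler0N1; lra.
  by have := sg1 (mu y - nu y); have := sg1 (mu y' - nu y'); lra.
rewrite /tv mulVKf// -sumrB; apply: eq_bigr => y _.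
by rewrite -mulrBr normrEsg.
Qed.

(** The kernel changes first, under the fixed measure [mu], at cost [a]. Then the measure changes,
    under the fixed kernel [l]: a test function of oscillation 2 has means under [l] of oscillation
    at most [2 * b]. *)
Lemma tv_mix (mu nu : dist R X) (k l : X -> dist R Y) (a b : R) :
  (forall x, tv (k x) (l x) <= a) -> (forall x x', tv (l x) (l x') <= b) ->
  tv (mix mu k) (mix nu l) <= a + b * tv mu nu.
Proof.
move=> ka lb; have [h h2 tvh] := tv_sgE (mix mu k) (mix nu l).
rewrite -(@ler_pM2l _ 2)// tvh !sum_mix.
have -> : \sum_x (\sum_y h y * k x y) * mu x
        - \sum_x (\sum_y h y * l x y) * nu x
  = \sum_x (\sum_y h y * k x y - \sum_y h y * l x y) * mu x
    + (\sum_x (\sum_y h y * l x y) * mu x - \sum_x (\sum_y h y * l x y) * nu x).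
  by rewrite addrA -big_split/=; congr (_ - _); apply: eq_bigr => x _; ring.
rewrite mulrDr mulrA; apply: lerD.
  apply: mean_le => x; apply: le_trans (sum_le_tv _ _ h2) _.
  by rewrite ler_pM2l.
apply: sum_le_tv => x x'; apply: le_trans (sum_le_tv _ _ h2) _.
by rewrite ler_pM2l.
Qed.

End Mixtures.

(** * Limits under geometric bounds *)

Lemma le_geometric (R : realType) (x y B k : R) :
  0 <= k < 1 -> (forall n : nat, x <= y + B * k ^+ n) -> x <= y.
Proof.
move=> /andP[k0 k1] xy.
have cv : (fun n => y + B * k ^+ n) @ \oo --> y.
  rewrite -[X in _ --> X]addr0 -(mulr0 B); apply: cvgD; first exact: cvg_cst.
  by apply: cvgMr; apply: cvg_expr; rewrite ger0_norm.
have <- := cvg_lim (@Rhausdorff R) cv.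
apply: limr_ge; first by apply/cvg_ex; exists y.
by apply: nearW => n; exact: xy.
Qed.

(** With [e n] the tail of the geometric series, the intervals of radius [e n] around [u n] are
    nested; the supremum of their left ends lies in all of them. *)
Lemma ex_geometric_limit (R : realType) (u : nat -> R) (B k : R) : 0 <= k < 1 ->
  (forall n, `|u n.+1 - u n| <= B * k ^+ n) ->
  exists l, forall n, `|u n - l| <= B / (1 - k) * k ^+ n.
Proof.
move=> /andP[k0 k1] du; set e := fun n => B / (1 - k) * k ^+ n.
have k1' : 0 < 1 - k by rewrite subr_gt0.
have B0 : 0 <= B by have := du 0%N; rewrite expr0 mulr1; exact: le_trans.
have e0 n : 0 <= e n by rewrite mulr_ge0 ?exprn_ge0// divr_ge0// ltW.
have eS n : e n = B * k ^+ n + e n.+1.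
  by rewrite /e exprS; field; rewrite gt_eqF.
have lo m n : u n - e n <= u (n + m)%N - e (n + m)%N.
  elim: m => [|m IH]; first by rewrite addn0.
  rewrite (le_trans IH)// addnS eS.
  by have := du (n + m)%N; rewrite ler_norml => /andP[]; lra.
have hi m n : u (n + m)%N + e (n + m)%N <= u n + e n.
  elim: m => [|m IH]; first by rewrite addn0.
  apply: le_trans IH; rewrite addnS [e (n + m)%N]eS.
  by have := du (n + m)%N; rewrite ler_norml => /andP[]; lra.
have lohi m n : u m - e m <= u n + e n.
  have := lo n m; have := hi m n; rewrite (addnC n).
  by have := e0 (m + n)%N; lra.
exists (sup [set u n - e n | n in setT]) => n.
have lub : u n - e n <= sup [set u n - e n | n in setT].
  apply: ub_le_sup; last by exists n.
  by exists (u n + e n) => _ [m _ <-].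
have glb : sup [set u n - e n | n in setT] <= u n + e n.
  by apply: ge_sup; [exists (u 0%N - e 0%N), 0%N|move=> _ [m _ <-]].
by rewrite ler_norml -/(e n); apply/andP; split; lra.
Qed.

(** * Regularized minimization *)

Lemma minval_argmin (R : realType) (U : Type) (g : U -> R) (u : U) :
  is_argmin g u -> minval g = g u.
Proof.
move=> gu; rewrite /minval; apply: xget_unique; first by split; first exists u.
by move=> _ [[v <-] vmin]; apply/eqP; rewrite eq_le vmin gu.
Qed.

Section Regularization.
Context {R : realType} {A : pointedFinType} {rho : R} {Omega : dist R A -> R}.
Context (rho_gt0 : 0 < rho) (Omega_cont : continuous Omega)
  (Omega_sc : strongly_convex rho Omega).

(** The shape of a Bellman right-hand side as a function of the control: a linear part plus the
    regularizer. *)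
Definition reg (g : A -> R) (u : dist R A) : R := \sum_a g a * u a + Omega u.

Lemma ex_argmin_continuous (h : dist R A -> R) :
  continuous h -> exists u, is_argmin h u.
Proof.
move=> ch; have [||u _ hu] := compact_EVT_min _ compact_dist (f := h).
- by exists point.
- by apply: continuous_subspaceT.
- by exists u => v; apply: hu; rewrite inE.
Qed.

Lemma ex_argmin_reg (g : A -> R) : exists u, is_argmin (reg g) u.
Proof.
have cg : continuous (fun u : dist R A => \sum_a g a * u a).
  apply: (continuous_big (op := +%R)) => [|a _ u]; first exact: add_continuous.
  by apply: continuousM; [exact: cst_continuous|exact: mass_continuous].
apply: ex_argmin_continuous => u.
by apply: continuousD; [exact: cg|exact: Omega_cont].
Qed.

Lemma Omega_bounded : exists B : R, forall u, `|Omega u| <= B.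
Proof.
have [u hu] := ex_argmin_continuous Omega_cont.
have [|v hv] := @ex_argmin_continuous (fun u => - Omega u).
  by move=> w; apply: continuousN; exact: Omega_cont.
exists (`|Omega u| + `|Omega v|) => w.
rewrite ler_norml; have := hu w; have := hv w.
have := ler_norm (Omega v); have := ler_norm (- Omega u); rewrite normrN.
have := normr_ge0 (Omega v); have := normr_ge0 (Omega u); lra.
Qed.

Lemma norm_reg_sub (g h : A -> R) (u : dist R A) (M : R) :
  (forall a, `|g a - h a| <= M) -> `|reg g u - reg h u| <= M.
Proof.
move=> ghM; rewrite /reg opprD addrACA subrr addr0 -sumrB.
by under eq_bigr do rewrite -mulrBl; exact: norm_mean_le.
Qed.

Lemma argmin_value_le (g h : A -> R) (u v : dist R A) (M : R) :
  (forall a, `|g a - h a| <= M) -> is_argmin (reg g) u -> is_argmin (reg h) v ->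
  `|reg g u - reg h v| <= M.
Proof.
move=> ghM gu hv.
have := norm_reg_sub u ghM; have := norm_reg_sub v ghM; rewrite !ler_norml.
have := gu v; have := hv u; lra.
Qed.

(** On the segment from [v] to [u], the mixture with weight [s] on [u] cannot beat the minimiser
    [u]. Dividing by [1 - s] leaves a factor [s], so the constant [rho / 2] is only approached as
    [s] tends to 1. *)
Lemma argmin_growth (g : A -> R) (u v : dist R A) (s : R) : 0 < s < 1 ->
  is_argmin (reg g) u -> reg g u + rho / 2 * s * norm1 u v ^+ 2 <= reg g v.
Proof.
move=> /andP[s0 s1] gu.
have [w0 w1] : (forall a, 0 <= s * u a + (1 - s) * v a) /\
    \sum_a (s * u a + (1 - s) * v a) = 1.
  split=> [a|]; last by rewrite big_split/= -!mulr_sumr !mass_sum1; lra.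
  by rewrite addr_ge0// mulr_ge0 ?mass_ge0// ?subr_ge0 ltW.
pose w := mkdist w0 w1.
have gw : reg g w <= s * reg g u + (1 - s) * reg g v
                     - rho / 2 * s * (1 - s) * norm1 u v ^+ 2.
  have := @Omega_sc u v w s.
  rewrite (ltW s0) (ltW s1) => /(_ erefl (fun=> erefl)).
  have -> : reg g w = s * (\sum_a g a * u a) + (1 - s) * (\sum_a g a * v a)
                      + Omega w.
    rewrite /reg; congr (_ + _); rewrite !mulr_sumr -big_split/=.
    by apply: eq_bigr => a _; rewrite mkdistE; ring.
  by rewrite /reg; lra.
have s1' : 0 < 1 - s by rewrite subr_gt0.
rewrite -(ler_pM2l s1'); have := gu w; lra.
Qed.

(** Adding the growth of [reg g] from [u] to [v] and that of [reg h] from [v] to [u] cancels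
    [Omega]: [rho * s * norm1 u v ^+ 2] is at most the pairing of [g - h] with [v - u], hence at
    most [M * norm1 u v]. *)
Lemma argmin_norm1_le (g h : A -> R) (u v : dist R A) (M : R) :
  (forall a, `|g a - h a| <= M) -> is_argmin (reg g) u -> is_argmin (reg h) v ->
  norm1 u v <= M / rho.
Proof.
move=> ghM gu hv; have [->|n_neq0] := eqVneq (norm1 u v) 0.
  by rewrite divr_ge0 ?(ltW rho_gt0)// (le_trans _ (ghM point)).
have n_gt0 : 0 < norm1 u v by rewrite lt0r n_neq0 norm1_ge0.
rewrite ler_pdivlMr// leNgt; apply/negP => Mlt.
have M0 : 0 <= M by rewrite (le_trans _ (ghM point)).
(* Any s < 1 with M < s rho |u - v| contradicts the two growth bounds. *)
pose s := (1 + M / (norm1 u v * rho)) / 2.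
have nr : 0 < norm1 u v * rho by rewrite mulr_gt0.
have q0 : 0 <= M / (norm1 u v * rho) by rewrite divr_ge0// ltW.
have q1 : M / (norm1 u v * rho) < 1 by rewrite ltr_pdivrMr// mul1r.
have s01 : 0 < s < 1 by rewrite /s; lra.
have vu : norm1 v u = norm1 u v.
  by apply: eq_bigr => a _; rewrite distrC.
have key : reg g v - reg g u + (reg h u - reg h v) <= M * norm1 u v.
  have -> : reg g v - reg g u + (reg h u - reg h v) =
      \sum_a (g a - h a) * (v a - u a).
    rewrite (eq_bigr
      (fun a => g a * v a - g a * u a + (h a * u a - h a * v a))).
      by rewrite big_split/= !sumrB /reg; ring.
    by move=> a _; ring.
  rewrite -vu mulr_sumr; apply: ler_sum => a _.
  by rewrite (le_trans (ler_norm _))// normrM ler_wpM2r.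
have := argmin_growth v s01 gu; have := argmin_growth u s01 hv; rewrite vu.
have : M * norm1 u v < rho * s * norm1 u v ^+ 2.
  have : M / (norm1 u v * rho) * (norm1 u v * rho) < s * (norm1 u v * rho).
    by rewrite ltr_pM2r// /s; lra.
  rewrite divfK ?gt_eqF// => Ms.
  rewrite expr2 mulrA ltr_pM2r ?lt0r ?n_neq0 ?norm1_ge0//; lra.
lra.
Qed.

Lemma argmin_unique (g : A -> R) (u v : dist R A) :
  is_argmin (reg g) u -> is_argmin (reg g) v -> u = v.
Proof.
move=> gu gv; apply: norm1_le0.
by rewrite (le_trans (argmin_norm1_le (M := 0) _ gu gv)) ?mul0r// => a;
  rewrite subrr normr0.
Qed.

Definition argmin_reg (g : A -> R) : dist R A := projT1 (cid (ex_argmin_reg g)).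

Lemma argmin_regP (g : A -> R) : is_argmin (reg g) (argmin_reg g).
Proof. exact: projT2 (cid (ex_argmin_reg g)). Qed.

End Regularization.

Arguments reg {R A} Omega g u.

(** * The game *)

Record lipschitz_game (R : realType) (X A : finType) (L1 K1 : R)
    (c : X -> A -> dist R X -> R) (p : X -> A -> dist R X -> dist R X) : Prop :=
  LipschitzGame {
    cost_lip : forall x x' a a' mu mu',
      `|c x a mu - c x' a' mu'| <= L1 * modulus x x' a a' mu mu';
    kernel_lip : forall x x' a a' mu mu',
      tv (p x a mu) (p x' a' mu') <= K1 / 2 * modulus x x' a a' mu mu' }.

Section Game.
Context {R : realType} {X : finType} {A : pointedFinType}.
Context {beta L1 K1 rho : R} {mu0 : dist R X} {c : X -> A -> dist R X -> R}
  {p : X -> A -> dist R X -> dist R X} {Omega : dist R A -> R}.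
Context (beta01 : 0 < beta < 1) (L1_gt0 : 0 < L1) (K1_gt0 : 0 < K1)
  (betaK1 : beta * K1 < 2)
  (game_lip : lipschitz_game L1 K1 c p)
  (rho_gt0 : 0 < rho) (Omega_cont : continuous Omega)
  (Omega_sc : strongly_convex rho Omega).

Let L := Lbar beta L1 K1.
Let Kb := Kbar beta L1 K1 rho.
Let Kh := Khat beta L1 K1 rho.

(** * Signs of the constants and identities between them *)

Lemma kappa01 : 0 < beta * K1 / 2 < 1.
Proof.
have /andP[b0 _] := beta01; have bK2 := betaK1.
have bK : 0 < beta * K1 by rewrite mulr_gt0.
by apply/andP; split; lra.
Qed.

Lemma Lbar_gt0 : 0 < L.
Proof. by have /andP[_ ?] := kappa01; rewrite /L /Lbar divr_gt0//; lra. Qed.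

(** [L] is the fixed point of the affine map, sending [O] to [L1 + beta * K1 / 2 * O], that bounds
    the oscillation of a value function by that of its successor. *)
Lemma LbarE : L1 + beta * K1 / 2 * L = L.
Proof.
have /andP[_ k1] := kappa01; have : 1 - beta * K1 / 2 != 0 by lra.
by rewrite /L /Lbar => ?; field; lra.
Qed.

Lemma KhatBE : Kh - Kb = K1 * L / rho.
Proof. by rewrite /Kh /Khat -/Kb -/L; ring. Qed.

Lemma KhatB_gt0 : 0 < Kh - Kb.
Proof. by rewrite KhatBE divr_gt0// mulr_gt0// Lbar_gt0. Qed.

(** The left-hand side is the coefficient that [next_lip] produces besides [Kh - Kb]; it is compared
    with [Kb] through [1 / (1 - beta) >= 1]. *)
Lemma Kbar_ge : 3 * K1 / 2 + K1 * L / (2 * rho) <= Kb.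
Proof.
have /andP[b0 b1] := beta01; rewrite /Kb /Kbar -/L lerD2l.
have r2 : 0 < 2 * rho by rewrite mulr_gt0.
have b' : 0 < 1 - beta by lra.
rewrite ler_pM2l ?(mulr_gt0 K1_gt0 Lbar_gt0)// lef_pV2 ?posrE ?(mulr_gt0 r2)//.
by rewrite ler_piMr ?ltW//; lra.
Qed.

Lemma Kbar_gt0 : 0 < Kb.
Proof.
have := Kbar_ge; have : 0 < K1 * L / (2 * rho).
  by rewrite divr_gt0 ?(mulr_gt0 K1_gt0 Lbar_gt0)// mulr_gt0.
by have := K1_gt0; lra.
Qed.

Lemma Khat_gt0 : 0 < Kh.
Proof. by have := KhatB_gt0; have := Kbar_gt0; lra. Qed.

(** * The Bellman operator and its Lipschitz estimates *)

Definition qval (mu : dist R X) (W : X -> R) (x : X) (a : A) : R :=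
  c x a mu + beta * \sum_y W y * p x a mu y.

(** The transition law under [u] is the mixture of the laws of the pure actions, so cost and
    continuation merge into the mean of [qval] over [u]. *)
Lemma bellmanE mu (Q : X -> dist R A -> R) x u :
  bellman beta c p Omega mu Q x u =
  reg Omega (qval mu (fun y => minval (Q y)) x) u.
Proof.
rewrite /bellman /reg /cost addrAC; congr (_ + _).
have -> : \sum_y minval (Q y) * trans p x u mu y =
          \sum_y minval (Q y) * mix u (fun a => p x a mu) y by [].
rewrite sum_mix mulr_sumr -big_split/=; apply: eq_bigr => a _.
by rewrite /qval; ring.
Qed.

Definition greedy (mu : dist R X) (W : X -> R) (x : X) : dist R A :=
  argmin_reg Omega_cont (qval mu W x).

Definition optval (mu : dist R X) (W : X -> R) (x : X) : R :=
  reg Omega (qval mu W x) (greedy mu W x).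

Lemma greedyP mu W x : is_argmin (reg Omega (qval mu W x)) (greedy mu W x).
Proof. exact: argmin_regP. Qed.

Definition next (mu : dist R X) (W : X -> R) : dist R X :=
  mix mu (fun x => mix (greedy mu W x) (fun a => p x a mu)).

(** The change of cost is charged to [L1], the change of kernel to the oscillation of [W] rather
    than its size, and the change of [W] to the discounted [S]. State and flow vary together so that
    one estimate serves both. *)
Lemma qval_lip (mu mu' : dist R X) (W W' : X -> R) (O S : R) x x' a :
  0 <= O -> (forall y y', W y - W y' <= O) -> (forall y, `|W y - W' y| <= S) ->
  `|qval mu W x a - qval mu' W' x' a| <=
    (L1 + beta * K1 / 2 * O) * ((x != x')%:R + 2 * tv mu mu') + beta * S.
Proof.
move=> O0 WO WS; have /andP[b0 b1] := beta01.
have cl := cost_lip game_lip x x' a a mu mu'.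
have pl := kernel_lip game_lip x x' a a mu mu'.
rewrite /modulus eqxx mulr0 addr0 in cl pl.
set m := (x != x')%:R + 2 * tv mu mu' in cl pl *.
have osc : `|\sum_y W y * p x a mu y - \sum_y W y * p x' a mu' y|
           <= O * (K1 / 2 * m).
  apply: (@le_trans _ _ (O * tv (p x a mu) (p x' a mu'))); last first.
    by rewrite ler_wpM2l.
  rewrite ler_norml lerNl opprB; apply/andP; split; last exact: sum_le_tv.
  by rewrite tv_sym; exact: sum_le_tv.
have dW : `|\sum_y W y * p x' a mu' y - \sum_y W' y * p x' a mu' y| <= S.
  by rewrite -sumrB; under eq_bigr do rewrite -mulrBl; exact: norm_mean_le.
have -> : qval mu W x a - qval mu' W' x' a = (c x a mu - c x' a mu')
  + beta * ((\sum_y W y * p x a mu y - \sum_y W y * p x' a mu' y)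
            + (\sum_y W y * p x' a mu' y - \sum_y W' y * p x' a mu' y)).
  by rewrite /qval; ring.
rewrite (le_trans (ler_normD _ _))// normrM (gtr0_norm b0).
have h := le_trans (ler_normD _ _) (lerD osc dW).
have := ler_wpM2l (ltW b0) h; lra.
Qed.

Lemma greedy_lip_state mu W x x' : (forall y y', W y - W y' <= L) ->
  norm1 (greedy mu W x) (greedy mu W x') <= L / rho.
Proof.
move=> WL; apply: (argmin_norm1_le rho_gt0 Omega_sc _ (greedyP _ _ _)
  (greedyP _ _ _)) => a.
rewrite (le_trans (@qval_lip _ _ _ _ L 0 _ _ _ _ WL _))//.
- exact: ltW Lbar_gt0.
- by move=> y; rewrite subrr normr0.
rewrite LbarE tvxx !mulr0 !addr0.
by have := Lbar_gt0; case: (x != x') => /=; lra.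
Qed.

Lemma qval_lip_flow mu mu' W W' S x a :
  (forall y y', W y - W y' <= L) -> (forall y, `|W y - W' y| <= S) ->
  `|qval mu W x a - qval mu' W' x a| <= 2 * L * tv mu mu' + beta * S.
Proof.
move=> WL WS; rewrite (le_trans (qval_lip _ _ _ _ _ (ltW Lbar_gt0) WL WS))//.
by rewrite LbarE eqxx add0r; lra.
Qed.

Lemma optval_lip mu mu' W W' S x :
  (forall y y', W y - W y' <= L) -> (forall y, `|W y - W' y| <= S) ->
  `|optval mu W x - optval mu' W' x| <= 2 * L * tv mu mu' + beta * S.
Proof.
move=> WL WS; apply: (argmin_value_le _ (greedyP _ _ _) (greedyP _ _ _)) => a.
exact: qval_lip_flow.
Qed.

Lemma optval_contract mu W W' S x :
  (forall y, `|W y - W' y| <= S) ->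
  `|optval mu W x - optval mu W' x| <= beta * S.
Proof.
move=> WS; have /andP[b0 _] := beta01.
apply: (argmin_value_le _ (greedyP _ _ _) (greedyP _ _ _)) => a.
rewrite /qval opprD addrACA subrr add0r -mulrBr normrM gtr0_norm// ler_pM2l//.
by rewrite -sumrB; under eq_bigr do rewrite -mulrBl; exact: norm_mean_le.
Qed.

(** As [L] is a fixed point ([LbarE]), only the excess of the oscillation over [L] is propagated,
    shrunk by [beta * K1 / 2 < 1]. *)
Lemma optval_osc mu W e x x' : 0 <= e -> (forall y y', W y - W y' <= L + e) ->
  optval mu W x - optval mu W x' <= L + beta * K1 / 2 * e.
Proof.
move=> e0 WL; apply: le_trans (ler_norm _) _.
apply: (argmin_value_le _ (greedyP _ _ _) (greedyP _ _ _)) => a.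
have Le0 : 0 <= L + e by rewrite addr_ge0// ltW// Lbar_gt0.
have WW y : `|W y - W y| <= 0 by rewrite subrr normr0.
rewrite (le_trans (qval_lip _ _ _ _ _ Le0 WL WW))// tvxx !mulr0 !addr0.
have := LbarE; have := Lbar_gt0; have /andP[k0 _] := kappa01.
have := mulr_ge0 (ltW k0) e0; case: (x != x') => /=; lra.
Qed.

(** The action indicator has weight 2 in [modulus], so kernels of two actions differ by at most
    [K1]; multiplied by [tv u u'], half of [norm1 u u'], this yields the coefficient [K1 / 2]. *)
Lemma tv_trans_le (u u' : dist R A) mu mu' x x' :
  tv (mix u (fun a => p x a mu)) (mix u' (fun a => p x' a mu'))
  <= K1 / 2 * ((x != x')%:R + 2 * tv mu mu' + norm1 u u').
Proof.
have h := @tv_mix R A X u u' (fun a => p x a mu) (fun a => p x' a mu')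
  (K1 / 2 * ((x != x')%:R + 2 * tv mu mu')) K1.
apply: le_trans (h _ _) _.
- move=> a; apply: le_trans (kernel_lip game_lip _ _ _ _ _ _) _.
  by rewrite /modulus eqxx mulr0 addr0.
- move=> a a'; apply: le_trans (kernel_lip game_lip _ _ _ _ _ _) _.
  rewrite /modulus eqxx tvxx mulr0 !addr0 add0r.
  by case: (a != a') => /=; have := K1_gt0; lra.
by rewrite (tvE u u'); lra.
Qed.

(** This is [tv_mix] over the current state: at a fixed state the law moves with [mu] and with the
    greedy control, and across states it varies by at most [K1 / 2 * (1 + L / rho)]. *)
Lemma next_lip mu mu' W W' S :
  (forall y y', W y - W y' <= L) -> (forall y y', W' y - W' y' <= L) ->
  (forall y, `|W y - W' y| <= S) ->
  tv (next mu W) (next mu' W')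
  <= Kh * tv mu mu' + beta * (K1 / (2 * rho)) * S.
Proof.
move=> WL W'L WS; set d := tv mu mu'.
have d0 : 0 <= d := tv_ge0 _ _.
have f1 x : norm1 (greedy mu W x) (greedy mu' W' x)
            <= (2 * L * d + beta * S) / rho.
  apply: (argmin_norm1_le rho_gt0 Omega_sc _ (greedyP _ _ _) (greedyP _ _ _)).
  by move=> a; exact: qval_lip_flow.
have h := @tv_mix R X X mu mu'
  (fun x => mix (greedy mu W x) (fun a => p x a mu))
  (fun x => mix (greedy mu' W' x) (fun a => p x a mu'))
  (K1 / 2 * (2 * d + (2 * L * d + beta * S) / rho)) (K1 / 2 * (1 + L / rho)).
have K2 : 0 < K1 / 2 by rewrite divr_gt0.
apply: le_trans (h _ _) _.
- move=> x; apply: le_trans (tv_trans_le _ _ _ _ _ _) _.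
  by rewrite eqxx add0r ler_pM2l// lerD2l.
- move=> x x'; apply: le_trans (tv_trans_le _ _ _ _ _ _) _.
  rewrite tvxx mulr0 addr0 ler_pM2l// lerD ?greedy_lip_state//.
  by case: (_ != _).
have := ler_wpM2r d0 Kbar_ge; rewrite -/d.
have -> : Kh = Kb + K1 * L / rho by have := KhatBE; lra.
move=> kb; apply: le_trans (_ : _ <= (3 * K1 / 2 + K1 * L / (2 * rho)) * d +
  K1 * L / rho * d + beta * (K1 / (2 * rho)) * S) _; last lra.
by rewrite le_eqVlt; apply/orP; left; apply/eqP; field; rewrite gt_eqF.
Qed.

(** * The weight [rate] and the contraction constant [factor] *)

Local Notation sk := (Num.sqrt Kh).
Local Notation sg := (Num.sqrt (Kh - Kb)).

Definition rate : R := Num.sqrt (Khat beta L1 K1 rho) / (beta *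
  (Num.sqrt (Khat beta L1 K1 rho)
   + Num.sqrt (Khat beta L1 K1 rho - Kbar beta L1 K1 rho))).

Definition factor : R := beta * (Num.sqrt (Khat beta L1 K1 rho)
   + Num.sqrt (Khat beta L1 K1 rho - Kbar beta L1 K1 rho)) ^+ 2.

Lemma sqrtKhat_gt0 : 0 < sk. Proof. by rewrite sqrtr_gt0 Khat_gt0. Qed.

Lemma sqrtKhatB_gt0 : 0 < sg. Proof. by rewrite sqrtr_gt0 KhatB_gt0. Qed.

Lemma rate_gt0 : 0 < rate.
Proof.
have /andP[b0 _] := beta01.
rewrite divr_gt0 ?sqrtKhat_gt0// mulr_gt0//.
by rewrite addr_gt0 ?sqrtKhat_gt0 ?sqrtKhatB_gt0.
Qed.

Lemma beta_rateE : beta * rate = sk / (sk + sg).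
Proof.
have /andP[b0 _] := beta01; have := sqrtKhat_gt0; have := sqrtKhatB_gt0.
by rewrite /rate -/Kh -/Kb => ? ?; field; rewrite !gt_eqF// addr_gt0.
Qed.

Lemma beta_rate_lt1 : beta * rate < 1.
Proof.
have h1 := sqrtKhat_gt0; have h2 := sqrtKhatB_gt0.
by rewrite beta_rateE ltr_pdivrMr ?addr_gt0// mul1r ltrDl.
Qed.

(* rate minimises the left-hand side, seen as a function of the rate. *)
Lemma factorE :
  Kh / rate + (Kh - Kb) * beta / (1 - beta * rate) = factor.
Proof.
have /andP[b0 _] := beta01; have h1 := sqrtKhat_gt0; have h2 := sqrtKhatB_gt0.
have e1 : Kh = sk ^+ 2 by rewrite sqr_sqrtr ?ltW ?Khat_gt0.
have e2 : Kh - Kb = sg ^+ 2 by rewrite sqr_sqrtr ?ltW ?KhatB_gt0.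
have s0 : 0 < sk + sg by rewrite addr_gt0.
have -> : 1 - beta * rate = sg / (sk + sg).
  by rewrite beta_rateE; field; rewrite gt_eqF.
rewrite /rate /factor -/Kh -/Kb {1}e1 [X in X * beta]e2.
by field; rewrite !gt_eqF.
Qed.

Lemma factor_gt0 : 0 < factor.
Proof.
have /andP[b0 _] := beta01.
by rewrite mulr_gt0// exprn_gt0// addr_gt0 ?sqrtKhat_gt0 ?sqrtKhatB_gt0.
Qed.

(** * Comparison of two flows up to a horizon *)

Definition bellman_upto (T : nat) (mu : nat -> dist R X) (V : nat -> X -> R) :=
  forall t x, (t < T)%N -> V t x = optval (mu t) (V t.+1) x.

Lemma bellman_upto_osc T mu V e : 0 <= e -> bellman_upto T mu V ->
  (forall y y', V T y - V T y' <= L + e) ->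
  forall t, (t <= T)%N -> forall y y',
    V t y - V t y' <= L + (beta * K1 / 2) ^+ (T - t) * e.
Proof.
(* Backward induction, on the number [T - t] of remaining steps. *)
move=> e0 bV VT t tT; rewrite -{1 2}(subKn tT).
have : (T - t <= T)%N by rewrite leq_subr.
elim: (T - t)%N => [_ y y'|k IH kT y y']; first by rewrite subn0 expr0 mul1r.
have kT' : (T - k.+1 < T)%N by rewrite ltn_subrL (leq_trans _ kT).
have e1 : (T - k.+1).+1 = (T - k)%N by rewrite -subSn.
rewrite !bV// e1 exprS -mulrA; apply: optval_osc; last exact/IH/ltnW.
by rewrite mulr_ge0// exprn_ge0// ltW//; have /andP[] := kappa01.
Qed.

(** The gap at [t] is at most [2 * L * m * rate ^+ t] plus [beta] times the gap at [t.+1]. The first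
    parts sum to a geometric series of ratio [beta * rate < 1]; the terminal gap [M] is
    discounted. *)
Lemma bellman_upto_diff T mu mu' V V' m M :
  0 <= m -> bellman_upto T mu V -> bellman_upto T mu' V' ->
  (forall t, (t <= T)%N -> forall y y', V t y - V t y' <= L) ->
  (forall x, `|V T x - V' T x| <= M) ->
  (forall t, (t < T)%N -> tv (mu t) (mu' t) <= m * rate ^+ t) ->
  forall t x, (t <= T)%N -> `|V t x - V' t x| <=
    2 * L * m * rate ^+ t / (1 - beta * rate) + beta ^+ (T - t) * M.
Proof.
move=> m0 bV bV' VL VM dm t x tT; have /andP[b0 _] := beta01.
have r0 := rate_gt0; have br1 := beta_rate_lt1; have L0 := Lbar_gt0.
have q0 : 0 < 1 - beta * rate by rewrite subr_gt0.
move: x; rewrite -{1 2 3}(subKn tT); have : (T - t <= T)%N by rewrite leq_subr.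
elim: (T - t)%N => [_ x|k IH kT x].
  rewrite subn0 expr0 mul1r (le_trans (VM x))// lerDr.
  have Lm0 : 0 <= 2 * L * m by rewrite mulr_ge0// mulr_ge0// ltW.
  by rewrite divr_ge0 ?(ltW q0)// mulr_ge0// exprn_ge0// ltW.
have kT' : (T - k.+1 < T)%N by rewrite ltn_subrL (leq_trans _ kT).
have e1 : (T - k.+1).+1 = (T - k)%N by rewrite -subSn.
rewrite bV// bV'// e1.
apply: le_trans (optval_lip _ _ _ (VL _ (leq_subr _ _)) (IH (ltnW kT))) _.
have := ler_wpM2l (ltW (mulr_gt0 (ltr0Sn R 1) L0)) (dm _ kT').
rewrite -e1 (exprS rate) (exprS beta) => hd.
apply: le_trans (lerD hd (lexx _)) _.
by rewrite le_eqVlt; apply/orP; left; apply/eqP; field; rewrite gt_eqF.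
Qed.

Lemma next_diff T mu mu' V V' m M :
  0 <= m -> bellman_upto T mu V -> bellman_upto T mu' V' ->
  (forall t, (t <= T)%N -> forall y y', V t y - V t y' <= L) ->
  (forall t, (t <= T)%N -> forall y y', V' t y - V' t y' <= L) ->
  (forall x, `|V T x - V' T x| <= M) ->
  (forall t, (t < T)%N -> tv (mu t) (mu' t) <= m * rate ^+ t) ->
  forall t, (t < T)%N ->
    tv (next (mu t) (V t.+1)) (next (mu' t) (V' t.+1)) <=
    factor * m * rate ^+ t.+1 + K1 / (2 * rho) * M * beta ^+ (T - t).
Proof.
move=> m0 bV bV' VL VL' VM dm t tT.
have br1 := beta_rate_lt1; have q0 : 0 < 1 - beta * rate by rewrite subr_gt0.
have r0 := rate_gt0.
apply: le_trans (next_lip _ _ (VL _ tT) (VL' _ tT)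
  (fun x => bellman_upto_diff m0 bV bV' VL VM dm x tT)) _.
have := ler_wpM2l (ltW Khat_gt0) (dm _ tT).
move=> hd; apply: le_trans (lerD hd (lexx _)) _.
(* Both terms of [factorE] appear: [Kh / rate] from the current measures, the other from the gap of
   the values at [t.+1]. *)
rewrite -factorE KhatBE -/Kh -/L.
have -> : (T - t)%N = (T - t.+1).+1 by rewrite -subSn.
rewrite le_eqVlt; apply/orP; left; apply/eqP; rewrite !exprS.
by field; rewrite !gt_eqF.
Qed.

(** * Bounded solutions over the infinite horizon *)

Definition bellman_bounded (mu : nat -> dist R X) (V : nat -> X -> R) :=
  (exists M : R, forall t x, `|V t x| <= M) /\
  (forall t x, V t x = optval (mu t) (V t.+1) x).

(** Truncation at any [T] is allowed because [bellman_upto] leaves the terminal value [V T] free. *)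
Lemma bellman_bounded_upto T mu V : bellman_bounded mu V -> bellman_upto T mu V.
Proof. by move=> [_ bV] t x _; exact: bV. Qed.

(** At time [t + n] the oscillation is at most [L + 2 * M]; going back [n] steps shrinks the excess
    [2 * M] geometrically, and [n] is arbitrary. *)
Lemma bellman_bounded_osc mu V : bellman_bounded mu V ->
  forall t y y', V t y - V t y' <= L.
Proof.
move=> bV t y y'; have [[M VM] _] := bV; have k01 := kappa01.
have M0 : 0 <= M by rewrite (le_trans _ (VM 0%N y)).
apply: (@le_geometric _ _ _ (2 * M) (beta * K1 / 2)) => [|n].
  by case/andP: k01 => k0 ->; rewrite ltW.
have M2 : 0 <= 2 * M by rewrite mulr_ge0.
have Vosc z z' : V (t + n)%N z - V (t + n)%N z' <= L + 2 * M.
  have := VM (t + n)%N z; have := VM (t + n)%N z'.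
  rewrite !ler_norml => /andP[? ?] /andP[? ?]; have := Lbar_gt0; lra.
have := bellman_upto_osc M2 (bellman_bounded_upto bV) Vosc (leq_addr n t) y y'.
by rewrite addKn [_ ^+ n * _]mulrC.
Qed.

(** With horizon [t + n.+1] the boundary term of [next_diff] is a multiple of [beta ^+ n.+1], and
    disappears as [n] grows. *)
Lemma next_diff_bounded mu mu' V V' m :
  0 <= m -> bellman_bounded mu V -> bellman_bounded mu' V' ->
  (forall t, tv (mu t) (mu' t) <= m * rate ^+ t) ->
  forall t, tv (next (mu t) (V t.+1)) (next (mu' t) (V' t.+1)) <=
            factor * m * rate ^+ t.+1.
Proof.
move=> m0 bV bV' dm t; have [[M VM] _] := bV; have [[M' VM'] _] := bV'.
have /andP[b0 b1] := beta01.
apply: (@le_geometric _ _ _ (K1 / (2 * rho) * (M + M') * beta) beta) => [|n].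
  by rewrite b1 ltW.
have tn : (t < t + n.+1)%N by rewrite -addn1 leq_add2l.
have VVM x : `|V (t + n.+1)%N x - V' (t + n.+1)%N x| <= M + M'.
  by rewrite (le_trans (ler_normB _ _))// lerD.
have := next_diff m0 (bellman_bounded_upto (T := t + n.+1) bV)
  (bellman_bounded_upto (T := t + n.+1) bV')
  (fun s _ => bellman_bounded_osc bV s)
  (fun s _ => bellman_bounded_osc bV' s) VVM (fun s _ => dm s) tn.
by rewrite addKn (exprS beta) mulrA.
Qed.

(** The uniform bound acts as a terminal condition at infinity: with the same flow on both sides
    ([m = 0]), only the terminal gap [M + M'] survives, discounted by [beta ^+ n]. *)
Lemma bellman_bounded_unique mu V V' :
  bellman_bounded mu V -> bellman_bounded mu V' -> forall t, V t = V' t.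
Proof.
move=> bV bV' t; apply: funext => x.
have [[M VM] _] := bV; have [[M' VM'] _] := bV'.
have /andP[b0 b1] := beta01.
apply/eqP; rewrite -subr_eq0 -normr_le0.
apply: (@le_geometric _ _ _ (M + M') beta) => [|n]; first by rewrite b1 ltW.
have VVM y : `|V (t + n)%N y - V' (t + n)%N y| <= M + M'.
  by rewrite (le_trans (ler_normB _ _))// lerD.
have d0 s : tv (mu s) (mu s) <= 0 * rate ^+ s by rewrite tvxx mul0r.
have := bellman_upto_diff (lexx 0) (bellman_bounded_upto (T := t + n) bV)
  (bellman_bounded_upto (T := t + n) bV')
  (fun s _ => bellman_bounded_osc bV s) VVM (fun s _ => d0 s)
  x (leq_addr n t).
by rewrite mulr0 !mul0r !add0r addKn mulrC.
Qed.

(** * Existence of the value functions and the induced flow *)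

Lemma reg_qval_bounded : exists B : R, forall mu x u W M,
  (forall y, `|W y| <= M) -> `|reg Omega (qval mu W x) u| <= B + beta * M.
Proof.
have [BO hBO] := Omega_bounded Omega_cont.
(* Costs are compared with those at the anchor [(point, mu0)]; [4] bounds [modulus] between two
   arguments sharing their state. Hence the bound is uniform in [mu]. *)
exists ((\sum_x `|c x point mu0| + 4 * L1) + BO) => mu x u W M WM.
have /andP[b0 _] := beta01.
rewrite /reg (le_trans (ler_normD _ _))// [leRHS]addrAC lerD//.
apply: norm_mean_le => a.
rewrite (le_trans (ler_normD _ _))// lerD//; last first.
  by rewrite normrM gtr0_norm// ler_pM2l//; exact: norm_mean_le.
have -> : c x a mu = c x point mu0 + (c x a mu - c x point mu0) by ring.
rewrite (le_trans (ler_normD _ _))// lerD//.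
  by rewrite (bigD1 x)//= lerDl; exact: sumr_ge0.
rewrite (le_trans (cost_lip game_lip _ _ _ _ _ _))//.
rewrite mulrC ler_wpM2r ?(ltW L1_gt0)//.
by rewrite /modulus eqxx; have := tv_le1 mu mu0; case: (_ != point) => /=; lra.
Qed.

(** The value at time [t] with [n] decisions left and terminal value zero. *)
Fixpoint value_iter (mu : nat -> dist R X) (n t : nat) : X -> R :=
  if n is n'.+1 then optval (mu t) (value_iter mu n' t.+1) else fun=> 0.

Lemma ex_bellman_bounded mu : exists V, bellman_bounded mu V.
Proof.
have /andP[b0 b1] := beta01; have b01 : 0 <= beta < 1 by rewrite ltW.
have b1' : 0 < 1 - beta by rewrite subr_gt0.
have [B hB] := reg_qval_bounded.
have dW n t x :
    `|value_iter mu n.+1 t x - value_iter mu n t x| <= B * beta ^+ n.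
  elim: n t x => [|n IH] t x.
    rewrite /= subr0 expr0 mulr1.
    have := hB (mu t) x (greedy (mu t) (fun=> 0) x) (fun=> 0) 0.
    by rewrite mulr0 addr0; apply=> y; rewrite normr0.
  by rewrite exprS mulrCA; apply: optval_contract => y; exact: IH.
have /choice[V hV] : forall t, exists v : X -> R, forall x n,
    `|value_iter mu n t x - v x| <= B / (1 - beta) * beta ^+ n.
  move=> t; have /choice[v hv] : forall x, exists l, forall n,
      `|value_iter mu n t x - l| <= B / (1 - beta) * beta ^+ n.
    by move=> x; apply: ex_geometric_limit.
  by exists v.
exists V; split; first exists (B / (1 - beta)) => t x.
  by have := hV t x 0%N; rewrite /= sub0r normrN expr0 mulr1.
(* [V t] and its Bellman update both lie within a multiple of [beta ^+ n.+1] of the iterate [n.+1],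
   for every [n]. *)
move=> t x; apply/eqP; rewrite -subr_eq0 -normr_le0.
apply: (le_geometric (B := 2 * beta * (B / (1 - beta))) b01) => n.
rewrite add0r.
have h1 := hV t x n.+1; rewrite distrC in h1.
have h2 : `|value_iter mu n.+1 t x - optval (mu t) (V t.+1) x| <=
    beta * (B / (1 - beta) * beta ^+ n).
  by apply: optval_contract => y; exact: hV.
rewrite (le_trans (ler_distD (value_iter mu n.+1 t x) _ _))//.
apply: le_trans (lerD h1 h2) _.
by rewrite exprS le_eqVlt; apply/orP; left; apply/eqP; ring.
Qed.

Definition value_of (mu : nat -> dist R X) : nat -> X -> R :=
  projT1 (cid (ex_bellman_bounded mu)).

Lemma value_ofP mu : bellman_bounded mu (value_of mu).
Proof. exact: projT2 (cid (ex_bellman_bounded mu)). Qed.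

(** Each step starts from the given measure [mu t'], not from the one just induced; the fixed points
    are the equilibrium flows. *)
Definition induced_flow (mu : nat -> dist R X) (t : nat) : dist R X :=
  if t is t'.+1 then next (mu t') (value_of mu t) else mu0.

(** * Consequences of the two conditions *)

Context (eps : R) (eps01 : 0 < eps < 1)
  (cond1 : beta `^ (1 - eps) < sk / (sk + sg))
  (cond2 : Num.sqrt (Kh * beta) + Num.sqrt ((Kh - Kb) * beta) < 1).

Lemma factor_lt1 : factor < 1.
Proof.
have /andP[b0 _] := beta01.
have -> : factor =
    (Num.sqrt (Kh * beta) + Num.sqrt ((Kh - Kb) * beta)) ^+ 2.
  rewrite !sqrtrM ?(ltW Khat_gt0) ?(ltW KhatB_gt0)// -mulrDl exprMn.
  by rewrite sqr_sqrtr ?(ltW b0)// mulrC.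
by rewrite expr_lt1// addr_ge0// sqrtr_ge0.
Qed.

Lemma factor01 : 0 <= factor < 1.
Proof. by rewrite factor_lt1 ltW// factor_gt0. Qed.

Lemma rate_powR_gt1 : 1 < rate * beta `^ eps.
Proof.
have /andP[b0 _] := beta01; have be0 : 0 < beta `^ eps by rewrite powR_gt0.
have e : beta `^ (1 - eps) * beta `^ eps = beta.
  by rewrite -powRD; [rewrite subrK powRr1// ltW|rewrite (gt_eqF b0) implybT].
have := cond1; rewrite -beta_rateE -(ltr_pM2r be0 (beta `^ (1 - eps))) e -mulrA.
by rewrite -{1}[beta]mulr1 (ltr_pM2l b0).
Qed.

Lemma powR_eps_ge_le1 : beta <= beta `^ eps <= 1.
Proof.
have /andP[b0 b1] := beta01; have /andP[e0 e1] := eps01.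
have b01 : 0 < beta <= 1 by rewrite b0 ltW.
apply/andP; split; first by rewrite -{1}(powRr1 (ltW b0)) ger_powR// ltW.
by rewrite -[leRHS](powRr0 beta) ger_powR// ltW.
Qed.

Lemma rate_ge1 : 1 <= rate.
Proof.
have /andP[_ h] := powR_eps_ge_le1.
rewrite (le_trans (ltW rate_powR_gt1))// ler_piMr// ltW//; exact: rate_gt0.
Qed.

(** The power [beta ^ (T eps)] is split over [j] and [T - j] steps: on the first,
    [rate * beta ^ eps > 1]; on the others, [beta <= beta ^ eps]. *)
Lemma expr_le_rate T j : (j <= T)%N ->
  beta ^+ (T - j) <= rate ^+ j * beta `^ (T%:R * eps).
Proof.
move=> jT; have /andP[b0 _] := beta01; have /andP[hb hb1] := powR_eps_ge_le1.
rewrite (mulrC T%:R) powRrM powR_mulrn ?powR_ge0//.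
rewrite -{2}(subnKC jT) exprD mulrA -exprMn -[leLHS]mul1r.
apply: ler_pM; rewrite ?exprn_ge0 ?(ltW b0)//.
  by rewrite exprn_ege1// ltW// rate_powR_gt1.
by apply: lerXn2r; rewrite ?nnegrE ?powR_ge0 ?(ltW b0).
Qed.

(** * Closeness, existence and uniqueness of equilibrium flows *)

Lemma flow_close T mu mu' V V' M : (0 < T)%N -> 0 <= M ->
  mu 0%N = mu' 0%N ->
  (forall t, (t.+1 < T)%N -> mu t.+1 = next (mu t) (V t.+1)) ->
  (forall t, (t.+1 < T)%N -> mu' t.+1 = next (mu' t) (V' t.+1)) ->
  bellman_upto T mu V -> bellman_upto T mu' V' ->
  (forall t, (t <= T)%N -> forall y y', V t y - V t y' <= L) ->
  (forall t, (t <= T)%N -> forall y y', V' t y - V' t y' <= L) ->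
  (forall x, `|V T x - V' T x| <= M) ->
  forall t, (t < T)%N -> tv (mu t) (mu' t) <=
    K1 / (2 * rho) * M / (1 - factor) * (rate ^+ t * beta `^ (T%:R * eps)).
Proof.
case: T => // T _ M0 mu00 muS mu'S bV bV' VL V'L VM.
have r0 := rate_gt0; have /andP[_ s1] := factor01.
have s1' : 0 < 1 - factor by rewrite subr_gt0.
pose d (i : 'I_T.+1) := tv (mu i) (mu' i) / rate ^+ i.
pose i := [arg max_(i > ord0) d i]%O; pose m := d i.
have dm j : (j < T.+1)%N -> tv (mu j) (mu' j) <= m * rate ^+ j.
  move=> jT; rewrite -ler_pdivrMr ?exprn_gt0//.
  by rewrite /m /i; case: arg_maxP => // k _ /(_ (Ordinal jT) isT).
have m0 : 0 <= m by rewrite divr_ge0 ?tv_ge0// exprn_ge0// ltW.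
set h := K1 / (2 * rho) * M * beta `^ (T.+1%:R * eps).
have K0 : 0 <= K1 / (2 * rho) * M.
  by rewrite mulr_ge0// ltW// divr_gt0// mulr_gt0.
have h0 : 0 <= h by rewrite mulr_ge0// powR_ge0.
(* The largest weighted distance [m] is attained either at time 0, where the flows agree, or at some
   [j.+1], where [next_diff] bounds it by [m] itself. *)
have mh : m <= factor * m + h.
  have sm0 : 0 <= factor * m by rewrite mulr_ge0// ltW// factor_gt0.
  rewrite {1}/m /d; case: (i : 'I__) => -[|j] /= jT.
    by rewrite mu00 tvxx mul0r addr_ge0.
  rewrite ler_pdivrMr ?exprn_gt0// muS// mu'S//.
  apply: le_trans (next_diff m0 bV bV' VL V'L VM dm (ltnW jT)) _.
  rewrite (mulrDl _ h) lerD2l /h -[leRHS]mulrA ler_wpM2l// (mulrC (beta `^ _)).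
  (* The boundary exponent is counted from [j] but [expr_le_rate] is used at [j.+1]; the spare
     factor [beta] is dropped. *)
  apply: le_trans (expr_le_rate (ltnW jT)).
  have /andP[b0 b1] := beta01.
  rewrite subSn; last by rewrite ltnW.
  by rewrite exprS ler_piMl ?exprn_ge0// ltW.
move=> t tT; apply: le_trans (dm _ tT) _.
have mle : m <= h / (1 - factor) by rewrite ler_pdivlMr//; lra.
apply: le_trans (ler_wpM2r (exprn_ge0 t (ltW r0)) mle) _.
by rewrite /h le_eqVlt; apply/orP; left; apply/eqP; ring.
Qed.

(** Picard iteration for the distance weighted by [rate ^+ t]. The first step has weighted length at
    most 1, since [tv] is at most 1 and [rate] at least 1; afterwards masses converge pointwise to a
    probability. *)
Lemma induced_flow_fixed : exists mu, forall t, mu t = induced_flow mu t.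
Proof.
have r0 := rate_gt0; have s01 := factor01; have /andP[s0 s1] := s01.
have s1' : 0 < 1 - factor by rewrite subr_gt0.
have rt0 t : 0 <= rate ^+ t by rewrite exprn_ge0// ltW.
have contr mu mu' m : 0 <= m ->
    (forall t, tv (mu t) (mu' t) <= m * rate ^+ t) ->
    forall t, tv (induced_flow mu t) (induced_flow mu' t)
              <= factor * m * rate ^+ t.
  move=> m0 dm [|t] /=; first by rewrite tvxx mulr_ge0// mulr_ge0.
  exact: (next_diff_bounded m0 (value_ofP mu) (value_ofP mu') dm).
pose U n := iter n induced_flow (fun=> mu0).
have dU n : forall t, tv (U n.+1 t) (U n t) <= factor ^+ n * rate ^+ t.
  elim: n => [|n IH] t.
    by rewrite mul1r (le_trans (tv_le1 _ _))// exprn_ege1// rate_ge1.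
  by rewrite exprS; apply: contr IH t; rewrite exprn_ge0.
have /choice[l hl] : forall t, exists f : X -> R, forall x n,
    `|U n t x - f x| <= 2 * rate ^+ t / (1 - factor) * factor ^+ n.
  move=> t; have /choice[f hf] : forall x, exists l, forall n,
      `|U n t x - l| <= 2 * rate ^+ t / (1 - factor) * factor ^+ n.
    move=> x; apply: ex_geometric_limit => // n.
    rewrite (le_trans (mass_sub_le_tv _ _ _))// -mulrA ler_wpM2l//.
    by rewrite mulrC dU.
  by exists f.
have l_ge0 t x : 0 <= l t x.
  rewrite -oppr_le0.
  apply: (le_geometric (B := 2 * rate ^+ t / (1 - factor)) s01) => n.
  have := hl t x n; rewrite ler_norml add0r => /andP[_].
  by have := mass_ge0 (U n t) x; lra.
have suml t n : `|\sum_x U n t x - \sum_x l t x| <=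
    \sum_(x : X) 2 * rate ^+ t / (1 - factor) * factor ^+ n.
  rewrite -sumrB (le_trans (ler_norm_sum _ _ _))//.
  by apply: ler_sum => x _; exact: hl.
have l_sum1 t : \sum_x l t x = 1.
  apply/eqP; rewrite eq_sym -subr_eq0 -normr_le0.
  pose S := \sum_(x : X) 2 * rate ^+ t / (1 - factor).
  apply: (le_geometric (B := S) s01) => n.
  by rewrite add0r /S mulr_suml; have := suml t n; rewrite mass_sum1.
pose nu t : dist R X := mkdist (l_ge0 t) (l_sum1 t).
(* Summing the pointwise bounds over the states; their [2] cancels the one half in [tv]. *)
pose C := \sum_(x : X) 1 / (1 - factor).
have C0 : 0 <= C by apply: sumr_ge0 => x _; rewrite divr_ge0// ltW.
have nuU n t : tv (nu t) (U n t) <= C * factor ^+ n * rate ^+ t.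
  rewrite tv_sym /tv -(@ler_pM2l _ 2)// mulVKf// /C !mulr_suml mulr_sumr.
  apply: ler_sum => x _; apply: le_trans (hl t x n) _.
  by rewrite le_eqVlt; apply/orP; left; apply/eqP; ring.
exists nu => t; apply/esym/tv_le0.
apply: (le_geometric (B := 2 * C * factor * rate ^+ t) s01) => n; rewrite add0r.
have Cn0 : 0 <= C * factor ^+ n by rewrite mulr_ge0// exprn_ge0.
have h1 := contr _ _ _ Cn0 (nuU n) t.
have h2 := nuU n.+1 t; rewrite tv_sym in h2.
apply: le_trans (tv_triangle (U n.+1 t) _ _) _.
apply: le_trans (lerD h1 h2) _.
by rewrite exprS le_eqVlt; apply/orP; left; apply/eqP; ring.
Qed.

(** Any two flows have weighted distance at most 1, as [tv] is at most 1 and [rate] at least 1;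
    applying the contraction [n] times brings it to [factor ^+ n]. *)
Lemma flow_unique mu mu' V V' :
  mu 0%N = mu' 0%N -> bellman_bounded mu V -> bellman_bounded mu' V' ->
  (forall t, mu t.+1 = next (mu t) (V t.+1)) ->
  (forall t, mu' t.+1 = next (mu' t) (V' t.+1)) -> mu = mu'.
Proof.
move=> mu00 bV bV' muS mu'S; have s01 := factor01; have /andP[s0 s1] := s01.
have r0 := rate_gt0.
have dn n : forall t, tv (mu t) (mu' t) <= factor ^+ n * rate ^+ t.
  elim: n => [|n IH] [|t].
  - by rewrite !mul1r tv_le1.
  - by rewrite mul1r (le_trans (tv_le1 _ _))// exprn_ege1// rate_ge1.
  - by rewrite mu00 tvxx mulr_ge0// exprn_ge0.
  - by rewrite muS mu'S (exprS factor); apply: next_diff_bounded bV bV' IH t;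
      rewrite exprn_ge0.
apply: funext => t; apply: tv_le0.
apply: (le_geometric (B := rate ^+ t) s01) => n.
by rewrite add0r mulrC dn.
Qed.

(** * Equilibria as flows with value functions *)

Lemma mfe_flow pi mu : is_mfe beta mu0 c p Omega pi mu ->
  exists2 V, bellman_bounded mu V &
    [/\ mu 0%N = mu0, forall t, mu t.+1 = next (mu t) (V t.+1) &
        forall t x, is_dirac (pi t x) (greedy (mu t) (V t.+1) x)].
Proof.
move=> [Q [f [mu00 [[M QM] QE] fmin fdir fnext]]].
(* Since minimisers are unique, [f] must be greedy for these minimal values, and the flow with [V]
   encodes the equilibrium. *)
pose V t x := Q t x (f t x).
have QV t x : Q t x = reg Omega (qval (mu t) (V t.+1) x).
  apply: funext => u; rewrite QE bellmanE; congr (reg _ (qval _ _ _) _).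
  by apply: funext => y; exact: minval_argmin.
have fE t x : f t x = greedy (mu t) (V t.+1) x.
  apply: (argmin_unique rho_gt0 Omega_sc _ (greedyP _ _ _)).
  by rewrite -QV; exact: fmin.
exists V; first split.
- by exists M => t x; exact: QM.
- by move=> t x; rewrite /V /optval -fE -QV.
split=> // t => [|x]; last by rewrite -fE.
by apply: dist_ext => y; rewrite fnext; apply: eq_bigr => x _; rewrite fE.
Qed.

Lemma mfe_fin_flow T pi mu : (0 < T)%N ->
  is_mfe_fin beta mu0 c p Omega T pi mu ->
  exists2 V, bellman_upto T mu V &
    [/\ V T = fun=> 0, mu 0%N = mu0 &
        forall t, (t.+1 < T)%N -> mu t.+1 = next (mu t) (V t.+1)].
Proof.
move=> T0 [Q [f [mu00 [QT QE] fmin _ fnext]]].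
(* The default 0 from time [T] on is a terminal condition: it makes the last stage, which has no
   continuation term, an instance of the recursion. *)
pose V t x := if (t < T)%N then Q t x (f t x) else 0.
have QV t x : (t < T)%N -> Q t x = reg Omega (qval (mu t) (V t.+1) x).
  move=> tT; apply: funext => u; have [tT'|Tt] := ltnP t.+1 T.
    rewrite QE// bellmanE; congr (reg _ (qval _ _ _) _).
    by apply: funext => y; rewrite /V tT'; apply: minval_argmin; exact: fmin.
  have tE : t = T.-1.
    by apply/eqP; rewrite eqn_leq -ltnS prednK// tT -ltnS prednK.
  rewrite tE QT -tE /reg; congr (_ + _); apply: eq_bigr => a _; congr (_ * _).
  rewrite /qval big1 ?mulr0 ?addr0// => y _.
  by rewrite /V ltnNge Tt mul0r.
have fE t x : (t < T)%N -> f t x = greedy (mu t) (V t.+1) x.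
  move=> tT; apply: (argmin_unique rho_gt0 Omega_sc _ (greedyP _ _ _)).
  by rewrite -QV//; exact: fmin.
exists V => [t x tT|]; first by rewrite {1}/V tT /optval -fE// -QV.
split=> // [|t tT]; first by apply: funext => x; rewrite /V ltnn.
apply: dist_ext => y; rewrite fnext//; apply: eq_bigr => x _.
by rewrite fE// ltnW.
Qed.

Definition greedy_policy (mu : nat -> dist R X) (V : nat -> X -> R) :
  policy R X A := fun t x => dirac (greedy (mu t) (V t.+1) x : borel_dist R A).

Lemma flow_mfe mu V : bellman_bounded mu V -> mu 0%N = mu0 ->
  (forall t, mu t.+1 = next (mu t) (V t.+1)) ->
  is_mfe beta mu0 c p Omega (greedy_policy mu V) mu.
Proof.
move=> [[M VM] VE] mu00 muS.
pose Q t x u := reg Omega (qval (mu t) (V t.+1) x) u.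
have QV t x : minval (Q t x) = V t x.
  by rewrite VE; apply: minval_argmin; exact: greedyP.
exists Q, (fun t x => greedy (mu t) (V t.+1) x); split=> //.
- split=> [|t x u].
    have [B hB] := reg_qval_bounded; exists (B + beta * M) => t x u.
    exact: hB.
  rewrite bellmanE /Q; congr (reg _ (qval _ _ _) _).
  by apply: funext => y; rewrite QV.
- by move=> t x; exact: greedyP.
- by move=> t y; rewrite muS.
Qed.

(** * The matrix [AT] and its spectral radius *)

Lemma AT_rate_le T (i : 'I_T.-1) :
  \sum_j AT beta L1 K1 rho T i j * rate ^+ j <= factor * rate ^+ i.
Proof.
have r0 := rate_gt0; have G0 := KhatB_gt0; have br1 := beta_rate_lt1.
have /andP[b0 _] := beta01.
have q0 : 0 < 1 - beta * rate by rewrite subr_gt0.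
rewrite -factorE mulrDl addrC.
pose a1 (j : nat) :=
  if (i <= j)%N then (Kh - Kb) * beta ^+ (j - i + 1) * rate ^+ j else 0.
pose a2 (j : nat) := if i == j.+1 :> nat then Kh * rate ^+ j else 0.
have -> : \sum_j AT beta L1 K1 rho T i j * rate ^+ j =
    \sum_(j < T.-1) a1 j + \sum_(j < T.-1) a2 j.
  rewrite -big_split/=; apply: eq_bigr => j _; rewrite mxE /a1 /a2.
  rewrite KhatBE (mulrC K1) -/L -/Kh; case: leqP => [ij|ji].
    by rewrite ltn_eqF ?ltnS// addr0.
  by case: ifP => _; rewrite ?mul0r add0r.
apply: lerD.
  (* A truncated geometric series of ratio [beta * rate] starting at [j = i]; for [n <= i] the
     truncated [n - i] is 0 and the formula gives 0. *)
  have -> n : \sum_(j < n) a1 j = (Kh - Kb) * beta / (1 - beta * rate) *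
      (1 - (beta * rate) ^+ (n - i)) * rate ^+ i.
    elim: n => [|n IH]; first by rewrite big_ord0 subrr mulr0 mul0r.
    rewrite big_ord_recr/= IH /a1; case: leqP => [ni|ni]; last first.
      have e m : (m <= i)%N -> (m - i = 0)%N by rewrite -subn_eq0 => /eqP.
      by rewrite addr0 !e// ltnW.
    rewrite subSn// exprS addn1 exprS -{3}(subnKC ni) exprD exprMn.
    by field; rewrite gt_eqF.
  rewrite ler_wpM2r ?exprn_ge0 ?(ltW r0)// ler_piMr ?divr_ge0 ?(ltW q0)//.
    by rewrite mulr_ge0// ltW.
  by rewrite gerBl exprn_ge0// mulr_ge0// ltW.
have : forall i' : nat, (i' < T.-1)%N -> (forall j : nat, a2 j =
    if i' == j.+1 then Kh * rate ^+ j else 0) ->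
    \sum_(j < T.-1) a2 j <= Kh / rate * rate ^+ i'.
  move=> [|i'] iT a2E.
    rewrite big1 => [|j _]; last by rewrite a2E.
    by rewrite expr0 mulr1; exact: divr_ge0 (ltW Khat_gt0) (ltW r0).
  rewrite (bigD1 (Ordinal (ltnW iT)))//= big1 => [|j /negbTE ji]; last first.
    by rewrite a2E eqSS eq_sym; move: ji; rewrite -val_eqE /= => ->.
  rewrite a2E eqxx addr0 exprS mulrA divfK// gt_eqF//.
by apply.
Qed.

Lemma rate_le_spectral T : (1 < T)%N -> rate <=
  Num.sqrt (Kh / (spectral_radius (AT beta L1 K1 rho T) * beta)).
Proof.
move=> T1; have r0 := rate_gt0; have /andP[b0 _] := beta01.
have AT_ge0 i j : 0 <= AT beta L1 K1 rho T i j.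
  rewrite mxE -/L; case: ifP => _; last by case: ifP; rewrite // ltW// Khat_gt0.
  rewrite mulr_ge0 ?exprn_ge0 ?(ltW b0)// divr_ge0 ?(ltW rho_gt0)//.
  by rewrite mulr_ge0// ltW// Lbar_gt0.
have trA : \tr (AT beta L1 K1 rho T) != 0.
  rewrite /mxtrace (eq_bigr (fun=> (Kh - Kb) * beta)) => [|i _].
    rewrite sumr_const card_ord mulrn_eq0 negb_or -lt0n.
    by case: (T) T1 => [|[|n]] //= _; rewrite gt_eqF// mulr_gt0// KhatB_gt0.
  by rewrite mxE leqnn subnn expr1 KhatBE (mulrC K1).
have /andP[l0 ls] := spectral_radius_gt0_le AT_ge0
  (fun i => exprn_gt0 i r0) (@AT_rate_le T) trA.
have f0 := factor_gt0; have h1 := sqrtKhat_gt0; have h2 := sqrtKhatB_gt0.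
rewrite -(ger0_norm (ltW r0)) -sqrtr_sqr ler_wsqrtr//.
(* With [factor] in place of the spectral radius the claim is an equality, and the spectral radius
   is positive and at most [factor]. *)
have -> : rate ^+ 2 = Kh / (factor * beta).
  rewrite -[Kh in RHS](sqr_sqrtr (ltW Khat_gt0)) /rate /factor -/Kh -/Kb.
  by field; rewrite !gt_eqF// addr_gt0.
rewrite ler_pM2l ?Khat_gt0// lef_pV2 ?posrE ?(mulr_gt0 _ b0)//.
by rewrite ler_pM2r.
Qed.

(** * The error bound and the unique equilibrium *)

Lemma mfe_fin_error pi mu (piT : nat -> policy R X A)
    (muT : nat -> nat -> dist R X) :
  is_mfe beta mu0 c p Omega pi mu ->
  (forall T, (2 <= T)%N -> is_mfe_fin beta mu0 c p Omega T (piT T) (muT T)) ->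
  exists (D : R) (T0 : nat), forall T t : nat, (T0 <= T)%N -> (t < T)%N ->
    tv (mu t) (muT T t)
    <= D * ((2 * T%:R - 1) / (T%:R - t%:R)
            * Num.sqrt (Kh / (spectral_radius (AT beta L1 K1 rho T) * beta))
              ^+ t
            * beta `^ (T%:R * eps)).
Proof.
move=> /mfe_flow[V bV [mu00 muS _]] mfeT; have [[M VM] _] := bV.
have M0 : 0 <= M.
  by have [x _] := dist_inhabited mu0; exact: le_trans (VM 0%N x).
have s1 : 0 < 1 - factor by rewrite subr_gt0 factor_lt1.
(* The constant of [flow_close]: the finite-horizon terminal value is 0, so the terminal gap is at
   most the uniform bound [M] of [V], whatever [T] is. *)
exists (K1 / (2 * rho) * M / (1 - factor)), 2 => T t T2 tT.
have [VT bVT [VT0 muT0 muTS]] := mfe_fin_flow (ltnW T2) (mfeT T T2).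
have VTosc s : (s <= T)%N -> forall y y', VT s y - VT s y' <= L.
  have VT_L y y' : VT T y - VT T y' <= L + 0.
    by rewrite VT0 subrr addr0 ltW// Lbar_gt0.
  move=> sT y y'; have := bellman_upto_osc (lexx 0) bVT VT_L sT y y'.
  by rewrite mulr0 addr0.
have VVT x : `|V T x - VT T x| <= M by rewrite VT0 subr0.
apply: le_trans (flow_close (ltnW T2) M0 (etrans mu00 (esym muT0))
  (fun s _ => muS s) muTS (bellman_bounded_upto bV) bVT
  (fun s _ => bellman_bounded_osc bV s) VTosc VVT tT) _.
have K0 : 0 <= K1 / (2 * rho) by rewrite divr_ge0 ?mulr_ge0 ?ltW.
apply: ler_wpM2l; first by rewrite divr_ge0 ?(ltW s1)// mulr_ge0.
rewrite ler_wpM2r ?powR_ge0//.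
have rt : rate ^+ t <= Num.sqrt
    (Kh / (spectral_radius (AT beta L1 K1 rho T) * beta)) ^+ t.
  apply: lerXn2r; rewrite ?nnegrE ?sqrtr_ge0 ?(ltW rate_gt0)//.
  exact: rate_le_spectral.
(* The remaining prefactor is at least 1 because [T - t <= 2 T - 1]. *)
apply: le_trans rt _; rewrite ler_peMl ?exprn_ge0 ?sqrtr_ge0//.
have tT' : t%:R < T%:R :> R by rewrite ltr_nat.
have T2' : 2 <= T%:R :> R by rewrite ler_nat.
have t0 : 0 <= t%:R :> R by rewrite ler0n.
by rewrite ler_pdivlMr ?subr_gt0//; lra.
Qed.

Lemma mfe_exists_unique :
  exists (pi : policy R X A) (mu : nat -> dist R X),
    is_mfe beta mu0 c p Omega pi mu /\
    forall (pi' : policy R X A) (mu' : nat -> dist R X),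
      is_mfe beta mu0 c p Omega pi' mu' ->
      (forall t, mu' t = mu t) /\
      (forall t x (B : set (borel_dist R A)), measurable B ->
         pi' t x B = pi t x B).
Proof.
have [mu mu_fixed] := induced_flow_fixed; pose V := value_of mu.
have mu00 : mu 0%N = mu0 by rewrite mu_fixed.
have muS t : mu t.+1 = next (mu t) (V t.+1) by rewrite {1}mu_fixed.
exists (greedy_policy mu V), mu; split.
  exact: flow_mfe (value_ofP mu) _ _.
move=> pi' mu' /mfe_flow[V' bV' [mu'0 mu'S dir]].
have mu'E : mu' = mu.
  by apply: flow_unique bV' (value_ofP mu) mu'S muS; rewrite mu00.
split=> [t|t x B mB]; first by rewrite mu'E.
(* Both policies are Dirac at greedy controls, which agree once the bounded value functions of the
   common flow are identified. *)
rewrite dir// mu'E (bellman_bounded_unique (mu := mu) (V := V') (V' := V)) //.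
- by rewrite -mu'E.
- exact: value_ofP.
Qed.

End Game.

Theorem theorem5 (R : realType) (X : finType) (A : pointedFinType)
  (beta L1 K1 rho : R) (mu0 : dist R X) (c : X -> A -> dist R X -> R)
  (p : X -> A -> dist R X -> dist R X) (Omega : dist R A -> R)
  (beta01 : 0 < beta < 1) (L1_gt0 : 0 < L1) (K1_gt0 : 0 < K1)
  (betaK1 : beta * K1 < 2)
  (c_lip : forall x x' a a' mu mu',
     `|c x a mu - c x' a' mu'| <= L1 * modulus x x' a a' mu mu')
  (p_lip : forall x x' a a' mu mu',
     tv (p x a mu) (p x' a' mu') <= K1 / 2 * modulus x x' a a' mu mu')
  (rho_gt0 : 0 < rho) (Omega_cont : continuous Omega)
  (Omega_sc : strongly_convex rho Omega)
  (Kb := Kbar beta L1 K1 rho) (Kh := Khat beta L1 K1 rho)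
  (eps : R) (eps01 : 0 < eps < 1)
  (cond1 : beta `^ (1 - eps)
           < Num.sqrt Kh / (Num.sqrt Kh + Num.sqrt (Kh - Kb)))
  (cond2 : Num.sqrt (Kh * beta) + Num.sqrt ((Kh - Kb) * beta) < 1) :
  (forall (pi : policy R X A) (mu : nat -> dist R X)
          (piT : nat -> policy R X A) (muT : nat -> nat -> dist R X),
     is_mfe beta mu0 c p Omega pi mu ->
     (forall T, (2 <= T)%N ->
        is_mfe_fin beta mu0 c p Omega T (piT T) (muT T)) ->
     exists (D : R) (T0 : nat), forall T t : nat, (T0 <= T)%N -> (t < T)%N ->
       tv (mu t) (muT T t)
       <= D * ((2 * T%:R - 1) / (T%:R - t%:R)
               * Num.sqrt (Kh / (spectral_radius (AT beta L1 K1 rho T) * beta))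
                 ^+ t
               * beta `^ (T%:R * eps)))
  /\
  (exists (pi : policy R X A) (mu : nat -> dist R X),
     is_mfe beta mu0 c p Omega pi mu /\
     forall (pi' : policy R X A) (mu' : nat -> dist R X),
       is_mfe beta mu0 c p Omega pi' mu' ->
       (forall t, mu' t = mu t) /\
       (forall t x (B : set (borel_dist R A)), measurable B ->
          pi' t x B = pi t x B)).
Proof.
have game_lip := LipschitzGame c_lip p_lip.
split=> [pi mu piT muT|].
  exact: (mfe_fin_error beta01 L1_gt0 K1_gt0 betaK1 game_lip rho_gt0 Omega_cont
    Omega_sc eps01 cond1 cond2).
exact: (mfe_exists_unique beta01 L1_gt0 K1_gt0 betaK1 game_lip rho_gt0
  Omega_cont Omega_sc eps01 cond1 cond2).
Qed.
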